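(* There is an absolute constant $c$ such that the following holds. Let $X$ be a semi-permutation, $T$ a partitioning tree for $X$, $U\subseteq V(T)$ a set of vertices such that every root-to-leaf path of $T$ contains exactly one vertex of $U$, and $(X^c,\{X^s_v\}_{v\in U})$ the split of $(X,T)$ at $U$. Then $$\mathrm{WB}(X)\le 4\,\mathrm{WB}(X^c)+8\sum_{v\in U}\mathrm{WB}(X^s_v)+c\,|X|.$$
   Context: Points have integer coordinates; a row (column) is active for $X$ if it contains a point of $X$; $X$ is a semi-permutation if each active row contains exactly one point of $X$. Strong Wilber bound: for a semi-permutation $Z$ with bounding box $B_Z$, let $\mathcal L(Z)$ be the vertical lines with half-integral $x$-coordinate strictly between the minimum and maximum $x$-coordinates of $Z$. For an ordering $\sigma$ of $\mathcal L(Z)$, process lines in order starting from the partition $\{B_Z\}$; each line $L$ splits the current vertical strip $S$ containing it into two, and is charged the number of indices $j$ such that $q_j,q_{j+1}$ lie on opposite sides of $L$, where $q_1,\dots,q_z$ are the points of $Z\cap S$ in increasing $y$-order. $\mathrm{WB}_\sigma(Z)$ is the total charge and $\mathrm{WB}(Z)=\max_\sigma\mathrm{WB}_\sigma(Z)$ ($=0$ if $Z$ has one active column). Partitioning tree for $X$: a rooted binary tree whose vertices $v$ carry closed vertical strips $S(v)$: the root carries the bounding box of $X$; an internal vertex $v$ owns a line $L(v)\in\mathcal L(X)$ strictly inside $S(v)$, and its two children carry the two strips into which $L(v)$ splits $S(v)$; each leaf strip contains exactly one active column of $X$. Split at $U$: for $v\in U$, $X^s_v=X\cap S(v)$; the compressed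 instance $X^c$ replaces, for each $v\in U$, every point $p\in X\cap S(v)$ by $(x_v,p.y)$, where $x_v$ is the $x$-coordinate of the leftmost active column of $X$ in $S(v)$. *)

(* Defs.v *)
From mathcomp Require Import all_boot all_order all_algebra.
Set Implicit Arguments. Unset Strict Implicit. Unset Printing Implicit Defensive.
Import Order.TTheory GRing.Theory Num.Theory.
Local Open Scope ring_scope.

(* A point is (x, y) with integer coordinates. A point set is a duplicate-free
   sequence of points; |X| = size X. *)
Definition point := (int * int)%type.

Definition semi_perm (X : seq point) : Prop :=
  uniq X /\ forall p q, p \in X -> q \in X -> p.2 = q.2 -> p = q.

(* minimum / maximum x-coordinate (meaningful for nonempty X) *)
Definition minx (X : seq point) : int :=
  foldr Order.min (head 0 (map fst X)) (map fst X).
Definition maxx (X : seq point) : int :=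
  foldr Order.max (head 0 (map fst X)) (map fst X).

(* A vertical line with half-integral x-coordinate k + 1/2 is encoded by k.
   L(Z): lines strictly between minx Z and maxx Z, i.e. minx Z <= k < maxx Z. *)
Definition lines (Z : seq point) : seq int :=
  if Z is [::] then [::]
  else [seq minx Z + (i%:Z) | i <- iota 0 `|maxx Z - minx Z|%N].

(* Points of Z in the current strip containing line k, after the lines in
   [done] have been processed: p is on the same side as line k of every
   processed line l. *)
Definition in_cur_strip (done : seq int) (k : int) (p : point) : bool :=
  all (fun l => (p.1 <= l) == (k <= l)) done.

Definition charge (Z : seq point) (done : seq int) (k : int) : nat :=
  let q := sort (fun p1 p2 : point => p1.2 <= p2.2)
                (filter (in_cur_strip done k) Z) in
  count (fun pq : point * point => (pq.1.1 <= k) != (pq.2.1 <= k))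
        (zip q (behead q)).

Fixpoint wb_aux (Z : seq point) (done : seq int) (s : seq int) : nat :=
  match s with
  | [::] => 0%N
  | k :: s' => (charge Z done k + wb_aux Z (k :: done) s')%N
  end.

Definition WB_sigma (Z : seq point) (sigma : seq int) : nat := wb_aux Z [::] sigma.

Definition WB (Z : seq point) : nat :=
  \max_(sigma <- permutations (lines Z)) WB_sigma Z sigma.

(* Partitioning trees.  A closed vertical strip whose left/right boundaries are
   box boundaries (integers) or lines (half-integers) is represented by the
   integer range [lo, hi] of the columns it contains.  A line k lies strictly
   inside the strip iff lo <= k < hi; it splits it into [lo,k] and [k+1,hi]. *)
Inductive ptree := Leaf | Node of int & ptree & ptree.

Definition in_strip (s : int * int) (p : point) : bool := (s.1 <= p.1) && (p.1 <= s.2).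

Definition ncols (X : seq point) (s : int * int) : nat :=
  size (undup [seq p.1 | p <- X & in_strip s p]).

Fixpoint valid_pt (X : seq point) (lo hi : int) (t : ptree) : Prop :=
  match t with
  | Leaf => ncols X (lo, hi) = 1%N
  | Node k l r => lo <= k < hi /\ valid_pt X lo k l /\ valid_pt X (k + 1) hi r
  end.

Definition is_ptree (X : seq point) (T : ptree) : Prop := valid_pt X (minx X) (maxx X) T.

(* Vertices of T are addressed by their path from the root
   (false = left child, true = right child). *)
Fixpoint strip_at (t : ptree) (lo hi : int) (v : seq bool) : option (int * int) :=
  match v, t with
  | [::], _ => Some (lo, hi)
  | b :: v', Node k l r => if b then strip_at r (k + 1) hi v' else strip_at l lo k v'
  | _ :: _, Leaf => None
  end.

Fixpoint is_leaf_at (t : ptree) (v : seq bool) : bool :=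
  match v, t with
  | [::], Leaf => true
  | b :: v', Node _ l r => if b then is_leaf_at r v' else is_leaf_at l v'
  | _, _ => false
  end.

Definition is_vertex (t : ptree) (v : seq bool) : bool := strip_at t 0 0 v != None.

Definition strip_of (X : seq point) (T : ptree) (v : seq bool) : int * int :=
  odflt (0, -1) (strip_at T (minx X) (maxx X) v).

Definition is_cut (T : ptree) (U : seq (seq bool)) : Prop :=
  uniq U /\ (forall u, u \in U -> is_vertex T u) /\
  (forall v, is_leaf_at T v -> count (fun u => prefix u v) U = 1%N).

Definition Xs (X : seq point) (T : ptree) (v : seq bool) : seq point :=
  [seq p <- X | in_strip (strip_of X T v) p].

Definition xv (X : seq point) (T : ptree) (v : seq bool) : int := minx (Xs X T v).

Definition compress_pt (X : seq point) (T : ptree) (U : seq (seq bool)) (p : point) : point :=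
  foldr (fun v q => if in_strip (strip_of X T v) p then (xv X T v, p.2) else q) p U.

Definition Xc (X : seq point) (T : ptree) (U : seq (seq bool)) : seq point :=
  map (compress_pt X T U) X.

(* Main.v *)
(* A processing order s is evaluated recursively on the list of columns of the
   points in increasing y-order: the first line k pays the number of switches
   between the two sides of k, and the rest of s is applied to both sides.
   Fix s, and let f be the monotone map that collapses every strip of U to one
   column.  A line that separates two strips is also processed in X^c; a line
   inside a strip is processed in that strip and, in X^c, is replaced by the two
   boundaries of its strip.  At any time the current piece of X consists of a
   part A of an already cut strip at its left end, of uncut strips M, and of a
   part B of an already cut strip at its right end, and X^c holds exactly M.
   The inequality cross_exchange, used once to remove A and once to remove B,
   bounds the charge by four times charges of X^c and of a strip, up to the
   decrease of the potential
     (switches between A and MB) + 2 (switches between M and B in MB) + 4 |M|.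
   The term 4 |M| pays for the parts A and B created by the first cut of a strip. *)
Require Import Defs.
From mathcomp Require Import all_boot all_order all_algebra.
From mathcomp Require Import zify.
Set Implicit Arguments. Unset Strict Implicit. Unset Printing Implicit Defensive.
Import Order.TTheory GRing.Theory Num.Theory.

(** * Switches of a predicate along a sequence *)

Section Crossings.
Variable T : Type.
Implicit Types (a b : pred T) (s : seq T) (o : option bool).

Definition switch o (x : bool) : nat := if o is Some y then (y != x : nat) else 0.

Fixpoint cross_from a o s : nat :=
  if s is x :: s' then switch o (a x) + cross_from a (Some (a x)) s' else 0.

Definition cross a s : nat := cross_from a None s.

Lemma crossE a s :
  cross a s = count (fun pq : T * T => a pq.1 != a pq.2) (zip s (behead s)).
Proof.
rewrite /cross; case: s => //= x s; rewrite add0n.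
by elim: s x => //= y s IHs x; rewrite IHs.
Qed.

Lemma eq_cross a b s : a =1 b -> cross a s = cross b s.
Proof.
rewrite /cross => eq_ab; elim: s None => //= x s IHs o.
by rewrite eq_ab IHs.
Qed.

Lemma crossC a s : cross (predC a) s = cross a s.
Proof. by rewrite !crossE; apply: eq_count => -[x y] /=; case: (a x) (a y) => [] []. Qed.

Lemma cross_le_count a s : cross a s <= 2 * count a s.
Proof.
suff H o : cross_from a o s <= 2 * count a s + (o == Some true) by have := H None; rewrite addn0.
elim: s o => //= x s IHs o; have := IHs (Some (a x)).
by case: o => [[]|]; case: (a x) => /=; lia.
Qed.

Lemma cross_le_countC a s : cross a s <= 2 * count (predC a) s.
Proof. by rewrite -crossC cross_le_count. Qed.

Lemma cross_eq0 a s : all a s -> cross a s = 0.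
Proof.
rewrite all_count => /eqP h; have := cross_le_countC a s.
by have := count_predC a s; lia.
Qed.

Lemma cross_eq0C a s : all (predC a) s -> cross a s = 0.
Proof. by move/cross_eq0; rewrite crossC. Qed.

(** A switch between elements that become adjacent forces a switch somewhere in the stretch between
    them. *)
Lemma cross_filter a b s : cross a (filter b s) <= cross a s.
Proof.
suff H o o' : cross_from a o (filter b s)
    <= cross_from a o' s + (if (o, o') is (Some x, Some y) then x != y else o != None).
  by have := H None None; rewrite addn0.
elim: s o o' => //= x s IHs o o'.
have := IHs (Some (a x)) (Some (a x)); have := IHs o (Some (a x)).
by case: (b x) => /=; case: o => [[]|]; case: o' => [[]|]; case: (a x) => /=; lia.
Qed.

(** In a switch of [b], either the element in [b] is also in [a], and the pair is a switch of [a],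
    or both elements are outside [a] and stay adjacent after the deletion. *)
Lemma cross_split a b s : subpred a b ->
  cross b s <= cross a s + cross b (filter (predC a) s).
Proof.
move=> sab.
(* [oa] and [ob] are the sides of the last element read, [o] the side on [b] of the last one outside
   [a]. *)
suff H oa ob o : [|| (oa, ob, o) == (None, None, None), oa == Some true
                   | (oa == Some false) && (o == ob)] ->
   (oa == Some true) ==> (ob == Some true) ->
   cross_from b ob s <= cross_from a oa s + cross_from b o (filter (predC a) s).
  exact: H.
elim: s oa ob o => //= x s IHs oa ob o.
have := @IHs (Some (a x)) (Some (b x)) (if a x then o else Some (b x)).
have : a x ==> b x by apply/implyP/sab.
case: (a x) => /=; case: (b x) => //= _;
case: oa => [[]|]; case: ob => [[]|]; case: o => [[]|] //= /(_ isT isT); lia.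
Qed.

(* Write A = a, B = b \ a and C for the complement of b.  A switch of b is an
   adjacent pair AC or BC, and a switch of a an adjacent pair AB or AC.  Every
   BC survives the deletion of A, and a switch of a created by the deletion of
   C comes from A C ... C B, which contains a BC. *)
Lemma cross_exchange a b s : subpred a b ->
  cross b s + cross a (filter b s) <= 2 * cross b (filter (predC a) s) + cross a s.
Proof.
move=> sab.
(* The last element read lies on sides ob of b and oa of a, the last one outside
   C on side v of a, and the last one outside A on side w of b.  One unit is
   saved while the last element is in C and the last one outside C is in B. *)
suff H ob oa v w : [|| (ob, oa, v, w) == (None, None, None, None),
    [&& ob == Some true, oa == Some true & v == Some true],
    (ob, oa, v, w) == (Some true, Some false, Some false, Some true) |
    [&& ob == Some false, oa == Some false & w == Some false]] ->
   cross_from b ob s + cross_from a v (filter b s) <=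
   2 * cross_from b w (filter (predC a) s) + cross_from a oa s
   + (if (ob, v) is (Some false, Some false) then 1 else 0).
  by have := H None None None None isT; rewrite addn0.
elim: s ob oa v w => //= x s IHs ob oa v w.
have := @IHs (Some (b x)) (Some (a x)) (if b x then Some (a x) else v)
  (if a x then w else Some (b x)).
have : a x ==> b x by apply/implyP/sab.
case ax: (a x); case bx: (b x) => //= _; rewrite ?ax /=;
case: ob => [[]|]; case: oa => [[]|]; case: v => [[]|]; case: w => [[]|] //= /(_ isT); lia.
Qed.

End Crossings.

Lemma cross_map (T T' : Type) (g : T' -> T) (a : pred T) (s : seq T') :
  cross a (map g s) = cross (a \o g) s.
Proof. by rewrite /cross; elim: s None => //= x s IHs o; rewrite IHs. Qed.

Lemma filterC (T : Type) (a b : pred T) s : filter a (filter b s) = filter b (filter a s).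
Proof. by rewrite -!filter_predI; apply: eq_filter => x /=; rewrite andbC. Qed.

Lemma filter_nil (T : Type) (a : pred T) s : all (predC a) s -> filter a s = [::].
Proof. by elim: s => //= x s IHs /andP[/negPf -> /IHs]. Qed.

(** * Recursive cost of a processing order *)

Definition left_of (k x : int) : bool := (x <= k)%R.

Fixpoint cost (P s : seq int) : nat :=
  if s is k :: s' then
    cross (left_of k) P + cost (filter (left_of k) P) s'
                        + cost (filter (predC (left_of k)) P) s'
  else 0.

Lemma cost_nil s : cost [::] s = 0.
Proof. by elim: s => //= k s ->. Qed.

Definition one_sided (k : int) (P : seq int) : bool :=
  all (left_of k) P || all (predC (left_of k)) P.

Lemma one_sided_filter k a P : one_sided k P -> one_sided k (filter a P).
Proof.
by case/orP => h; apply/orP; [left|right]; apply/allP => x;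
  rewrite mem_filter => /andP[_]; apply/allP.
Qed.

Lemma cost_one_sided k s P : one_sided k P -> cost P (k :: s) = cost P s.
Proof.
case/orP => h /=.
  rewrite cross_eq0 // (all_filterP h) filter_nil ?cost_nil ?addn0 //.
  by apply: sub_all h => x /= ->.
by rewrite cross_eq0C // (all_filterP h) filter_nil // cost_nil.
Qed.

(** One-sidedness passes to subsequences, so such a line is free wherever it occurs in the order. *)
Lemma cost_filter_lines (a : pred int) P s :
  (forall k, ~~ a k -> one_sided k P) -> cost P (filter a s) = cost P s.
Proof.
elim: s P => //= k s IHs P h.
have h' c k' : ~~ a k' -> one_sided k' (filter c P) by move/h; apply: one_sided_filter.
case: ifP => [_ /=|/negbT/h hk]; first by rewrite !IHs //; apply: h'.
by rewrite IHs //; apply/esym/(cost_one_sided s hk).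
Qed.

Lemma cost_cat P s1 s2 : cost P s1 <= cost P (s1 ++ s2).
Proof.
elim: s1 P => //= k s IHs P.
by have := IHs (filter (left_of k) P); have := IHs (filter (predC (left_of k)) P); lia.
Qed.

(** Both halves are one-sided for a line already processed, so its later occurrences are free.
    Compressed orders may contain repeats, while [WB] ranges over permutations. *)
Lemma cost_uniq s : exists t, [/\ uniq t, {subset t <= s} & forall P, cost P s = cost P t].
Proof.
have [n] := ubnP (size s); elim: n s => // n IHn [|k s]; first by exists [::].
move=> /= sz.
have [|t [ut st ct]] := IHn (filter (predC1 k) s).
  by rewrite size_filter; apply: leq_ltn_trans (count_size _ _) _.
exists (k :: t); split=> /=.
- by rewrite ut andbT; apply/negP => /st; rewrite mem_filter /= eqxx.
- move=> x; rewrite !inE; case: eqP => //= _ /st; rewrite mem_filter => /andP[_ ->].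
  by rewrite ?orbT.
- move=> P; rewrite -!ct; congr (_ + _ + _); apply/esym/cost_filter_lines.
    by move=> j; rewrite /= negbK => /eqP ->; rewrite /one_sided filter_all.
  by move=> j; rewrite /= negbK => /eqP ->; rewrite /one_sided filter_all orbT.
Qed.

(** * The Wilber bound as a recursive cost *)

Definition cols (Z : seq point) : seq int :=
  map fst (sort (fun p q : point => (p.2 <= q.2)%R) Z).

Lemma mem_cols Z x : (x \in cols Z) = (x \in map fst Z).
Proof. by apply: perm_mem; apply: perm_map; rewrite perm_sort. Qed.

Lemma cols_filter (a : pred int) Z :
  cols [seq p <- Z | a p.1] = filter a (cols Z).
Proof.
rewrite /cols filter_map -filter_sort //.
  by move=> p q; apply: le_total.
by move=> p q r; apply: le_trans.
Qed.

Lemma cols_map (g : point -> point) (h : int -> int) Z :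
  {in Z, forall p, g p = (h p.1, p.2)} -> cols (map g Z) = map h (cols Z).
Proof.
move=> /eq_in_map ->; rewrite /cols sort_map -!map_comp.
by apply: eq_map => p.
Qed.

Lemma chargeE Z done k :
  charge Z done k = cross (left_of k) (cols (filter (in_cur_strip done k) Z)).
Proof. by rewrite /charge cross_map crossE. Qed.

(** The last entry [j] is the line processed first. The half across [j] from [k] contributes zero,
    as all its columns are on one side of [k]. *)
Lemma charge_rcons Z done j k :
  charge Z (rcons done j) k = charge [seq p <- Z | left_of j p.1] done k
                            + charge [seq p <- Z | ~~ left_of j p.1] done k.
Proof.
rewrite !chargeE -!filter_predI.
have E p : in_cur_strip (rcons done j) k p
         = in_cur_strip done k p && (left_of j p.1 == left_of j k).
  by rewrite /in_cur_strip all_rcons andbC.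
rewrite (eq_filter E); case hk: (left_of j k).
  rewrite [X in _ = _ + X]cross_eq0C ?addn0.
    by congr (cross _ (cols _)); apply: eq_filter => p /=; rewrite eqb_id.
  apply/allP => x; rewrite mem_cols => /mapP[p]; rewrite mem_filter /= => /andP[/andP[_ h] _] ->.
  by move: h hk; rewrite /left_of; lia.
rewrite [X in _ = X + _]cross_eq0 ?add0n.
  by congr (cross _ (cols _)); apply: eq_filter => p /=; rewrite eqbF_neg.
apply/allP => x; rewrite mem_cols => /mapP[p]; rewrite mem_filter /= => /andP[/andP[_ h] _] ->.
by move: h hk; rewrite /left_of; lia.
Qed.

Lemma wb_aux_rcons Z done j s :
  wb_aux Z (rcons done j) s = wb_aux [seq p <- Z | left_of j p.1] done s
                            + wb_aux [seq p <- Z | ~~ left_of j p.1] done s.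
Proof.
elim: s done => //= k s IHs done.
by rewrite charge_rcons -rcons_cons IHs; lia.
Qed.

Lemma WB_sigmaE Z s : WB_sigma Z s = cost (cols Z) s.
Proof.
elim: s Z => //= k s IHs Z.
rewrite /WB_sigma /= -[[:: k]]/(rcons [::] k) wb_aux_rcons chargeE filter_predT.
rewrite -![wb_aux _ [::] s]/(WB_sigma _ s) !IHs addnA (cols_filter (left_of k)).
by rewrite (cols_filter (predC (left_of k))).
Qed.

Lemma minx_maxxP Z p : p \in Z -> (minx Z <= p.1 <= maxx Z)%R.
Proof.
rewrite /minx /maxx => /(map_f fst); move: (head _ _) => x0.
by elim: (map fst Z) p.1 => //= x s IHs y; rewrite inE => /predU1P[->|/IHs]; lia.
Qed.

Lemma minx_mem Z : Z != [::] -> exists2 p : point, p \in Z & minx Z = p.1.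
Proof.
case: Z => // p Z _; apply/mapP; rewrite /minx /=.
have : foldr Order.min p.1 (map fst Z) \in p.1 :: map fst Z.
  elim: (map fst Z) p.1 => [|x s IHs] y /=; first exact: mem_head.
  have := IHs y; rewrite minElt; case: ifP; rewrite !inE ?eqxx ?orbT //.
  by move=> _ /orP[] -> ; rewrite ?orbT.
by rewrite minElt; case: ifP => // _ _; rewrite mem_head.
Qed.

Lemma lines_uniq Z : uniq (lines Z).
Proof.
by case: Z => // p Z; rewrite /lines map_inj_uniq ?iota_uniq // => i j; lia.
Qed.

Lemma mem_lines Z k : Z != [::] -> (k \in lines Z) = (minx Z <= k < maxx Z)%R.
Proof.
move=> nZ; have [p /minx_maxxP hp _] := minx_mem nZ.
have -> : lines Z = [seq (minx Z + i%:Z)%R | i <- iota 0 `|maxx Z - minx Z|] by case: Z nZ {hp}.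
apply/mapP/idP => [[i]|hk]; first by rewrite mem_iota; lia.
by exists `|k - minx Z|%N; rewrite ?mem_iota; lia.
Qed.

(** Dropping repeats and lines that miss the bounding box is free, and appending the missing lines
    cannot lower the cost; this yields a permutation of [lines Z]. *)
Lemma cost_le_WB Z s : cost (cols Z) s <= WB Z.
Proof.
have [->|nZ] := eqVneq Z [::]; first by rewrite cost_nil.
have [t [ut _ ->]] := cost_uniq s.
pose t1 := filter (mem (lines Z)) t.
pose t2 := filter (predC (mem t1)) (lines Z).
have -> : cost (cols Z) t = cost (cols Z) t1.
  apply/esym/cost_filter_lines => k; rewrite inE mem_lines // => hk.
  have h x : x \in cols Z -> (minx Z <= x <= maxx Z)%R.
    by rewrite mem_cols => /mapP[p /minx_maxxP ? ->].
  have [lk|lk] := leP (maxx Z) k; apply/orP; [left|right]; apply/allP => x /h /=;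
    rewrite /left_of; lia.
apply: leq_trans (cost_cat _ t1 t2) _; rewrite -WB_sigmaE /WB.
apply: (@leq_bigmax_seq _ _ _ _ (t1 ++ t2)) => //.
rewrite mem_permutations; apply: uniq_perm; last 1 first.
- move=> k; rewrite mem_cat [k \in t2]mem_filter /= !mem_filter /=.
  by case: (k \in lines Z) (k \in t) => [] [].
- rewrite cat_uniq !filter_uniq ?lines_uniq //= andbT.
  by apply/hasPn => k; rewrite mem_filter /= => /andP[].
- exact: lines_uniq.
Qed.

(** * Cost under a monotone collapse of strips to columns *)

Section Split.
Variables (f : int -> int) (V : seq int).
Hypothesis f_mono : forall x y : int, (x <= y)%R -> (f x <= f y)%R.

Implicit Types (a b c k x : int) (P M s : seq int).

Notation fle a := (fun x : int => (f x <= a)%R).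
Notation flt b := (fun x : int => (f x < b)%R).
Notation L k := (left_of k).
Notation R k := (predC (left_of k)).

Lemma f_step k x :
  ((x <= k) ==> (f x <= f k))%R && ((k < x) ==> (f (k + 1) <= f x))%R.
Proof.
by apply/andP; split; apply/implyP => h; apply: f_mono; lia.
Qed.

(** The columns of uncut strips; [a] and [b] are the images of the end strips that may be cut
    already. *)
Definition mid (a b : int) (P : seq int) := filter (flt b) (filter (predC (fle a)) P).

Lemma mid_filter a b (p : pred int) P : mid a b (filter p P) = filter p (mid a b P).
Proof. by rewrite /mid !(filterC _ p). Qed.

Lemma mem_mid a b P x : x \in mid a b P -> (a < f x < b)%R.
Proof. by rewrite !mem_filter /=; lia. Qed.

Definition potential (a b : int) (P : seq int) :=
  cross (fle a) P + 2 * cross (flt b) (filter (predC (fle a)) P) + 4 * size (mid a b P).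

(* f k < f (k + 1) means that k separates two strips; otherwise the two lines
   isolate the column f k of the strip that contains k. *)
Definition compress_line k : seq int :=
  if (f k < f (k + 1))%R then [:: f k] else [:: (f k - 1)%R; f k].

Definition compress_lines s := flatten (map compress_line s).

Definition fiber_cost s P := \sum_(c <- V) cost (filter (fun x => f x == c) P) s.

Definition in_range (a b : int) (P : seq int) :=
  forall x, x \in P -> (a <= f x <= b)%R && (f x \in V).

Lemma in_range_filter a b a' b' (p : pred int) P : in_range a b P ->
  (forall x, p x -> (a <= f x <= b)%R -> (a' <= f x <= b')%R) ->
  in_range a' b' (filter p P).
Proof.
by move=> hP h x; rewrite mem_filter => /andP[px /hP/andP[hx ->]]; rewrite h.
Qed.

Lemma fiber_cost_split k s P :
  fiber_cost s (filter (L k) P) + fiber_cost s (filter (R k) P) <= fiber_cost (k :: s) P.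
Proof.
rewrite /fiber_cost -big_split /=; apply: leq_sum => c _.
by rewrite !(filterC (fun x => f x == c)) -addnA leq_addl.
Qed.

(** The term of [c] pays for its own switches; the other fibers are only split. If [c] is outside
    [V], its fiber in [P] is empty. *)
Lemma fiber_cost_cross k s P a b c : in_range a b P ->
  cross (L k) (filter (fun x => f x == c) P)
  + (fiber_cost s (filter (L k) P) + fiber_cost s (filter (R k) P))
  <= fiber_cost (k :: s) P.
Proof.
move=> hP; have [cV|cV] := boolP (c \in V); last first.
  rewrite [filter (fun x => f x == c) P]filter_nil ?fiber_cost_split //.
  by apply/allP => x /hP /andP[_ fV] /=; apply: contraNneq cV => <-.
rewrite /fiber_cost -big_split /= !(big_rem c cV) /=.
rewrite addnA; apply: leq_add.
  by rewrite addnA !(filterC (fun x => f x == c)).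
by apply: leq_sum => d _; rewrite !(filterC (fun x => f x == d)) -addnA leq_addl.
Qed.

(** [cross_exchange] deletes the end part at [a], then, mirrored, the end part at [b] from what
    remains. Each use doubles the remaining switches, whence the factor 4 and the weight 2 in the
    potential. *)
Lemma cross_central k a b P : (f k < b)%R -> (a < f (k + 1))%R ->
  cross (L k) P + cross (fle a) (filter (L k) P)
    + 2 * cross (flt b) (filter (predC (fle a)) (filter (R k) P))
  <= 4 * cross (L k) (mid a b P) + cross (fle a) P
    + 2 * cross (flt b) (filter (predC (fle a)) P).
Proof.
move=> kb ak.
have H1 := @cross_exchange _ (fle a) (L k) P.
have H2 := @cross_exchange _ (predC (flt b)) (R k) (filter (predC (fle a)) P).
have {}H1 := H1 ltac:(move=> x /=; have := f_step k x; rewrite /left_of; lia).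
have {}H2 := H2 ltac:(move=> x /=; have := f_step k x; rewrite /left_of; lia).
move: H2; rewrite !crossC filterC.
rewrite (@eq_filter _ (predC (predC (flt b))) (flt b)) => [H2|x /=]; last by rewrite negbK.
by rewrite /mid; lia.
Qed.

Lemma cost_compress_boundary k s M : (f k < f (k + 1))%R ->
  cost (map f M) (compress_lines (k :: s)) =
  cross (L k) M + cost (map f (filter (L k) M)) (compress_lines s)
  + cost (map f (filter (R k) M)) (compress_lines s).
Proof.
move=> hk; rewrite /compress_lines /= {1}/compress_line hk /= cross_map !filter_map.
have E x : left_of (f k) (f x) = left_of k x.
  by have := f_step k x; rewrite /left_of; lia.
congr (_ + cost (map f _) _ + cost (map f _) _).
- exact: eq_cross.
- exact: eq_filter.
- by apply: eq_filter => x /=; rewrite E.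
Qed.

(** [cross_split] is used at the left boundary of strip [c] and, mirrored, at the right one; only
    the fiber of [c] survives both deletions. *)
Lemma cost_compress_inside k c s M : f k = c -> f (k + 1) = c ->
  cross (L k) M + cost (map f (filter (flt c) M)) (compress_lines s)
  + cost (map f (filter (predC (fle c)) M)) (compress_lines s)
  <= cost (map f M) (compress_lines (k :: s)) + cross (L k) (filter (fun x => f x == c) M).
Proof.
move=> fk fk1.
have -> : compress_lines (k :: s) = [:: c - 1, c & compress_lines s]%R.
  by rewrite /compress_lines /= {1}/compress_line fk fk1 ltxx.
have H1 := @cross_split _ (flt c) (L k) M
  ltac:(move=> x /=; have := f_step k x; rewrite /left_of; lia).
have H2 := @cross_split _ (predC (fle c)) (R k) (filter (predC (flt c)) M)
  ltac:(move=> x /=; have := f_step k x; rewrite /left_of; lia).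
have E x : left_of (c - 1) (f x) = (f x < c)%R by rewrite /left_of; lia.
have I1 : filter (predC (predC (fle c))) (filter (predC (flt c)) M)
        = filter (fun x => f x == c) M.
  by rewrite -filter_predI; apply: eq_filter => x /=; lia.
have I2 : filter (predC (fle c)) (filter (predC (flt c)) M) = filter (predC (fle c)) M.
  by rewrite -filter_predI; apply: eq_filter => x /=; lia.
have E1 : cost (map f (filter (flt c) M)) (c :: compress_lines s)
        = cost (map f (filter (flt c) M)) (compress_lines s).
  apply: cost_one_sided; apply/orP; left; apply/allP => _ /mapP[x + ->].
  by rewrite mem_filter /left_of; lia.
have F1 : filter (left_of (c - 1)) (map f M) = map f (filter (flt c) M).
  by rewrite filter_map; congr map; apply: eq_filter => x /=.
have F2 : filter (predC (left_of (c - 1))) (map f M) = map f (filter (predC (flt c)) M).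
  by rewrite filter_map; congr map; apply: eq_filter => x /=; rewrite E.
have F3 : filter (predC (left_of c)) (map f (filter (predC (flt c)) M))
        = map f (filter (predC (fle c)) M).
  by rewrite filter_map -I2; congr map; apply: eq_filter => x /=.
have X1 : cross (left_of (c - 1)) (map f M) = cross (flt c) M.
  by rewrite cross_map; apply: eq_cross => x /=.
have X2 : cross (left_of c) (map f (filter (predC (flt c)) M))
        = cross (fle c) (filter (predC (flt c)) M).
  by rewrite cross_map; apply: eq_cross.
move: H2; rewrite I1 !crossC => H2.
rewrite [cost (map f M) _]/= -/(cost _ (c :: compress_lines s)) F1 F2 E1.
by rewrite /= X1 X2 F3; lia.
Qed.

Lemma cost_compress_one_sided k s M :
  all (fun j => one_sided j (map f M)) (compress_line k) ->
  cost (map f M) (compress_lines (k :: s)) = cost (map f M) (compress_lines s).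
Proof.
rewrite /compress_lines /=; elim: (compress_line k) => // j l IHl /= /andP[hj /IHl <-].
exact: cost_one_sided.
Qed.

Lemma count_addn_le (p q r : pred int) (P : seq int) :
  (forall x, p x + q x <= r x) -> count p P + count q P <= count r P.
Proof. by move=> h; elim: P => //= x P; have := h x; lia. Qed.

(** Induction on the order with [a] and [b] general: the first cut of a strip makes it the right end
    of one half and the left end of the other. *)
Lemma cost_decomposition s P a b : (a < b)%R -> in_range a b P ->
  cost P s <= 4 * cost (map f (mid a b P)) (compress_lines s)
              + 4 * fiber_cost s P + potential a b P.
Proof.
elim: s P a b => [|k s IHs] P a b ab hP; first by [].
have trivial : one_sided k P ->
    all (fun j => one_sided j (map f (mid a b P))) (compress_line k) ->
    cost P (k :: s) <= 4 * cost (map f (mid a b P)) (compress_lines (k :: s))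
              + 4 * fiber_cost (k :: s) P + potential a b P.
  move=> hk hc; rewrite cost_one_sided // cost_compress_one_sided //.
  have -> : fiber_cost (k :: s) P = fiber_cost s P.
    by apply: eq_bigr => c _; apply/cost_one_sided/one_sided_filter.
  exact: IHs.
have Rl x : x \in P -> (a <= f x <= b)%R by case/hP/andP.
have IL := IHs (filter (L k) P) a b ab (in_range_filter hP (fun _ _ => id)).
have IR := IHs (filter (R k) P) a b ab (in_range_filter hP (fun _ _ => id)).
have FS := fiber_cost_split k s P.
have M1 : size (filter (L k) (mid a b P)) + size (filter (R k) (mid a b P)) = size (mid a b P).
  by move: (mid a b P) => M; rewrite !size_filter count_predC.
have [|ne] := eqVneq (f k) (f (k + 1)%R); last first.
- have hk : (f k < f (k + 1))%R by have := @f_mono k (k + 1)%R; lia.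
  have [bk|kb] := leP b (f k).
    apply: trivial.
      by apply/orP; left; apply/allP => x /Rl; have := f_step k x; rewrite /left_of; lia.
    rewrite /compress_line hk /= andbT; apply/orP; left.
    by apply/allP => _ /mapP[x /mem_mid + ->]; rewrite /left_of; lia.
  have [ka|ak] := leP (f (k + 1)) a.
    apply: trivial.
      by apply/orP; right; apply/allP => x /Rl; have := f_step k x; rewrite /= /left_of; lia.
    rewrite /compress_line hk /= andbT; apply/orP; right.
    by apply/allP => _ /mapP[x /mem_mid + ->]; rewrite /= /left_of; lia.
  have G := cross_central P kb ak.
  (* The left half misses strip [b] and the right half misses strip [a], so each keeps one switch
     term of the potential. *)
  have ZL : cross (flt b) (filter (predC (fle a)) (filter (L k) P)) = 0.
    apply/cross_eq0/allP => x; rewrite !mem_filter; have := f_step k x; rewrite /left_of; lia.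
  have ZR : cross (fle a) (filter (R k) P) = 0.
    apply/cross_eq0C/allP => x; rewrite !mem_filter /=; have := f_step k x; rewrite /left_of; lia.
  rewrite cost_compress_boundary //.
  by move: IL IR; rewrite /potential ![mid _ _ (filter _ _)]mid_filter /=; lia.
(* From here on [k] lies inside a strip [c]. *)
move: {2}(f k) (erefl (f k)) => c fk; rewrite fk => /esym fk1.
have kR x : (c < f x)%R -> R k x by have := f_step k x; rewrite /= /left_of; lia.
have kL x : (f x < c)%R -> L k x by have := f_step k x; rewrite /= /left_of; lia.
have [ca|ac|ca] := ltgtP c a.
- apply: trivial.
    by apply/orP; right; apply/allP => x /Rl h; apply: kR; lia.
  rewrite /compress_line fk fk1 ltxx /= andbT; apply/andP; split; apply/orP; right;
    by apply/allP => _ /mapP[x /mem_mid + ->]; rewrite /= /left_of; lia.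
- have [cb|bc|cb] := ltgtP c b.
  + have hL : in_range a c (filter (L k) P).
      by apply: in_range_filter hP _ => x; have := f_step k x; rewrite /left_of; lia.
    have hR : in_range c b (filter (R k) P).
      by apply: in_range_filter hP _ => x; have := f_step k x; rewrite /= /left_of; lia.
    have {hL}IL := IHs _ a c ac hL; have {hR}IR := IHs _ c b cb hR.
    have G := @cross_central k a b P ltac:(lia) ltac:(lia).
    have CI := cost_compress_inside s (mid a b P) fk fk1.
    have {}FS := fiber_cost_cross k s c hP.
    have Ec : filter (fun x => f x == c) (mid a b P) = filter (fun x => f x == c) P.
      by rewrite /mid -!filter_predI; apply: eq_filter => x /=; lia.
    have EL : mid a c (filter (L k) P) = filter (flt c) (mid a b P).
      rewrite /mid -!filter_predI; apply: eq_filter => x /=.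
      by have := f_step k x; rewrite /left_of; lia.
    have ER : mid c b (filter (R k) P) = filter (predC (fle c)) (mid a b P).
      rewrite /mid -!filter_predI; apply: eq_filter => x /=.
      by have := f_step k x; rewrite /left_of; lia.
    (* Each column of fiber [c] is in at most two new switches, of weight 2 in the left potential
       and 1 in the right one. This costs at most 4 per column, released as these columns leave the
       middle. *)
    have B1 := cross_le_countC (flt c) (filter (predC (fle a)) (filter (L k) P)).
    have B2 := cross_le_count (fle c) (filter (R k) P).
    have B3 := cross_filter (flt b) (predC (fle c)) (filter (predC (fle a)) (filter (R k) P)).
    have E3 : filter (predC (fle c)) (filter (predC (fle a)) (filter (R k) P))
            = filter (predC (fle c)) (filter (R k) P).
      by rewrite -filter_predI; apply: eq_filter => x /=; lia.
    have N1 : count (predC (flt c)) (filter (predC (fle a)) (filter (L k) P))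
           + count (fle c) (filter (R k) P)
           <= size (filter (fun x => f x == c) P).
      rewrite !count_filter size_filter; apply: count_addn_le => x /=.
      by have := f_step k x; rewrite /left_of; lia.
    have N2 : size (filter (flt c) (mid a b P)) + size (filter (fun x => f x == c) P)
              + size (filter (predC (fle c)) (mid a b P)) <= size (mid a b P).
      rewrite -Ec; move: (mid a b P) => M; rewrite !size_filter -(count_predC (flt c) M).
      by rewrite -addnA leq_add2l; apply: count_addn_le => x /=; lia.
    rewrite E3 in B3; rewrite Ec in CI; move: IL IR; rewrite /potential EL ER /=.
    lia.
  + apply: trivial.
      by apply/orP; left; apply/allP => x /Rl h; apply: kL; lia.
    rewrite /compress_line fk fk1 ltxx /= andbT; apply/andP; split; apply/orP; left;
      by apply/allP => _ /mapP[x /mem_mid + ->]; rewrite /= /left_of; lia.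
  + have C0 : cost (map f (mid a b P)) (compress_lines (k :: s))
            = cost (map f (mid a b P)) (compress_lines s).
      apply: cost_compress_one_sided.
      rewrite /compress_line fk fk1 ltxx /= andbT; apply/andP; split; apply/orP; left;
        by apply/allP => _ /mapP[x /mem_mid + ->]; rewrite /= /left_of; lia.
    (* Here [k] cuts the right end strip. The exchanges delete the part at [a], then the middle,
       leaving switches within fiber [b] with factor 4. *)
    have X1 := @cross_exchange _ (fle a) (L k) P
      ltac:(move=> x /=; have := f_step k x; rewrite /left_of; lia).
    have X2 := @cross_exchange _ (flt b) (L k) (filter (predC (fle a)) P)
      ltac:(move=> x /=; have := f_step k x; rewrite /left_of; lia).
    have EQ : filter (L k) (filter (predC (fle a)) P)
            = filter (predC (fle a)) (filter (L k) P) by exact: filterC.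
    have Eb : filter (predC (flt b)) (filter (predC (fle a)) P) = filter (fun x => f x == b) P.
      by rewrite -filter_predI; apply: eq_in_filter => x /Rl /=; lia.
    have {}FS := fiber_cost_cross k s b hP.
    have EL : filter (L k) (mid a b P) = mid a b P.
      by apply/all_filterP/allP => x /mem_mid ?; apply: kL; lia.
    have ER : filter (R k) (mid a b P) = [::].
      by apply/filter_nil/allP => x /mem_mid h /=; rewrite negbK; apply: kL; lia.
    have Z1 : cross (fle a) (filter (R k) P) = 0.
      apply/cross_eq0C/allP => x; rewrite mem_filter /=; have := f_step k x; have := kL x.
      by rewrite /= /left_of; lia.
    have Z2 : cross (flt b) (filter (predC (fle a)) (filter (R k) P)) = 0.
      apply/cross_eq0C/allP => x; rewrite !mem_filter /=; have := kL x.
      by rewrite /= /left_of; lia.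
    move: IL IR X1 X2; rewrite /potential ![mid _ _ (filter _ _)]mid_filter /=.
    rewrite EL ER /= cost_nil EQ Eb Z1 Z2 C0; lia.
- have ab' : (c < b)%R by lia.
  have C0 : cost (map f (mid a b P)) (compress_lines (k :: s))
          = cost (map f (mid a b P)) (compress_lines s).
    apply: cost_compress_one_sided.
    rewrite /compress_line fk fk1 ltxx /= andbT; apply/andP; split; apply/orP; right;
      by apply/allP => _ /mapP[x /mem_mid + ->]; rewrite /= /left_of; lia.
  (* Here [k] cuts the left end strip; one exchange deletes everything outside fiber [a]. *)
  have X2 := @cross_exchange _ (predC (fle a)) (R k) P
    ltac:(move=> x /=; have := f_step k x; rewrite /left_of; lia).
  have EQ : filter (predC (fle a)) (filter (R k) P) = filter (predC (fle a)) P.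
    by rewrite -filter_predI; apply: eq_filter => x; have := kR x; rewrite /=; lia.
  have EQ' : filter (predC (fle a)) (filter (L k) P) = [::].
    apply/filter_nil/allP => x; rewrite mem_filter /=; have := kR x.
    by rewrite /= /left_of; lia.
  have Ea : filter (predC (predC (fle a))) P = filter (fun x => f x == a) P.
    by apply: eq_in_filter => x /Rl /=; lia.
  have {}FS := fiber_cost_cross k s a hP.
  have EL : filter (L k) (mid a b P) = [::].
    by apply/filter_nil/allP => x /mem_mid ?; apply: kR; lia.
  have ER : filter (R k) (mid a b P) = mid a b P.
    by apply/all_filterP/allP => x /mem_mid ?; apply: kR; lia.
  have Z1 : cross (fle a) (filter (L k) P) = 0.
    apply/cross_eq0/allP => x; rewrite mem_filter /=; have := kR x.
    by rewrite /= /left_of; lia.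
  move: IL IR X2; rewrite /potential ![mid _ _ (filter _ _)]mid_filter /= !crossC.
  rewrite EL ER /= cost_nil Ea EQ EQ' Z1 C0 /=; rewrite [cross _ [::]]/cross /=; lia.
Qed.

(** With [a] and [b] beyond all images there are no end parts: the switch terms of the potential
    vanish and the middle is all of [P]. *)
Lemma cost_split_bound s P a b :
  (forall x, x \in P -> (a < f x < b)%R && (f x \in V)) ->
  cost P s <= 4 * cost (map f P) (compress_lines s) + 4 * fiber_cost s P + 4 * size P.
Proof.
case: P => [|x0 P0]; first by rewrite cost_nil.
move: (x0 :: P0) (mem_head x0 P0) => P x0P hP.
have ab : (a < b)%R by have := hP _ x0P; lia.
have hR : in_range a b P by move=> x /hP; lia.
have := cost_decomposition s ab hR.
have midE : mid a b P = P.
  by rewrite /mid -filter_predI; apply/all_filterP/allP => x /hP /=; lia.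
rewrite /potential midE cross_eq0C; last by apply/allP => x /hP /=; lia.
rewrite cross_eq0; first by lia.
by apply/allP => x; rewrite mem_filter => /andP[_ /hP] /=; lia.
Qed.

End Split.

(** * Strips of a partitioning tree *)

Lemma valid_pt_mem X lo hi t : valid_pt X lo hi t ->
  exists2 p : point, p \in X & (lo <= p.1 <= hi)%R.
Proof.
elim: t lo hi => [|k l IHl r _] lo hi /=; last first.
  by move=> [hk [/IHl[p pX hp] _]]; exists p => //; lia.
rewrite /ncols; case E: [seq p <- X | in_strip (lo, hi) p] => [|p s] // _.
have : p \in [seq p <- X | in_strip (lo, hi) p] by rewrite E mem_head.
by rewrite mem_filter => /andP[h pX]; exists p.
Qed.

Lemma strip_at_sub X lo hi t v S : valid_pt X lo hi t -> strip_at t lo hi v = Some S ->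
  [/\ (lo <= S.1)%R, (S.2 <= hi)%R & exists2 p : point, p \in X & in_strip S p].
Proof.
elim: v t lo hi => [|b v IHv] [|k l r] lo hi //=.
- by move=> h [<-]; split=> //; apply: (@valid_pt_mem _ _ _ Leaf).
- by move=> h [<-]; split=> //; apply: (@valid_pt_mem _ _ _ (Node k l r)).
move=> [hk [hl hr]]; case: b => h.
  by have [? ? ?] := IHv _ _ _ hr h; split=> //; lia.
by have [? ? ?] := IHv _ _ _ hl h; split=> //; lia.
Qed.

Fixpoint leaf_of (t : ptree) (x : int) : seq bool :=
  if t is Node k l r then
    if (x <= k)%R then false :: leaf_of l x else true :: leaf_of r x
  else [::].

Lemma leaf_ofP t x : is_leaf_at t (leaf_of t x).
Proof. by elim: t => //= k l IHl r IHr; case: ifP. Qed.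

(** Existence of a path depends on the tree alone, so the bounds 0, 0 in [is_vertex] are
    immaterial. *)
Lemma is_vertexP t lo hi v : is_vertex t v -> exists S, strip_at t lo hi v = Some S.
Proof.
rewrite /is_vertex; move: 0%R {2}0%R => lo' hi'.
elim: v t lo hi lo' hi' => [|b v IHv] [|k l r] lo hi lo' hi' //=; try by eexists.
by case: b; apply: IHv.
Qed.

(** Turns membership in strips into the prefix condition of [is_cut]. Off the path to [x], the strip
    lies across the branching line. *)
Lemma strip_at_prefix X lo hi t v S x : valid_pt X lo hi t ->
  strip_at t lo hi v = Some S -> (lo <= x <= hi)%R ->
  (S.1 <= x <= S.2)%R = prefix v (leaf_of t x).
Proof.
elim: v t lo hi => [|b v IHv] [|k l r] lo hi //=.
- by move=> _ [<-].
- by move=> _ [<-]; rewrite prefix0s.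
move=> [hk [hl hr]] hS hx; case: b hS => hS; case: ifP => xk; rewrite prefix_cons /=.
- by have [? ? _] := strip_at_sub hr hS; lia.
- by apply: IHv hS _ => //; lia.
- by apply: IHv hS _ => //; lia.
- by have [? ? _] := strip_at_sub hl hS; lia.
Qed.

(** * Compression at a cut *)

Section Cut.
Variables (X : seq point) (T : ptree) (U : seq (seq bool)).
Hypotheses (ptT : is_ptree X T) (cutU : is_cut T U).

Definition in_cols (v : seq bool) (x : int) : bool :=
  ((strip_of X T v).1 <= x <= (strip_of X T v).2)%R.

Lemma cut_unique x : (minx X <= x <= maxx X)%R ->
  exists u, [/\ u \in U, in_cols u x & forall v, v \in U -> in_cols v x -> v = u].
Proof.
move=> hx; have [_ [Uv Uc]] := cutU.
have pre v : v \in U -> in_cols v x = prefix v (leaf_of T x).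
  move=> /Uv /(@is_vertexP _ (minx X) (maxx X)) [S hS].
  by rewrite /in_cols /strip_of hS; apply: strip_at_prefix ptT hS hx.
have := Uc _ (leaf_ofP T x); rewrite -size_filter.
case E: [seq u <- U | prefix u _] => [|u [|]] // _.
have mem v : (v \in U) && in_cols v x = (v == u).
  rewrite -mem_seq1 -E mem_filter andbC.
  by case vU: (v \in U); rewrite ?andbF ?andbT //= pre.
have /andP[uU ux] : (u \in U) && in_cols u x by rewrite mem eqxx.
by exists u; split=> // v vU vx; apply/eqP; rewrite -mem vU.
Qed.

Lemma xv_in_cols v : v \in U -> in_cols v (xv X T v) && (minx X <= xv X T v <= maxx X)%R.
Proof.
have [_ [Uv _]] := cutU.
move=> /Uv /(@is_vertexP _ (minx X) (maxx X)) [S hS].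
have [h1 h2 [p pX pS]] := strip_at_sub ptT hS.
have : Xs X T v != [::].
  apply/eqP => E; have : p \in Xs X T v by rewrite mem_filter /strip_of hS pX andbT.
  by rewrite E.
case/minx_mem => q; rewrite mem_filter => /andP[qS qX] Eq.
by rewrite /xv Eq minx_maxxP // andbT.
Qed.

(* Clamping to the bounding box makes the compression monotone on all integers. *)
Definition clamp x := Order.max (minx X) (Order.min (maxx X) x).

(** The ordinate 0 is arbitrary: strips test abscissas only. *)
Definition compress_col (x : int) : int := (compress_pt X T U (clamp x, 0%R)).1.

Lemma compress_ptE p : (minx X <= p.1 <= maxx X)%R ->
  compress_pt X T U p = (compress_col p.1, p.2).
Proof.
case: p => x y /= hx; rewrite /compress_col.
have -> : clamp x = x by rewrite /clamp; lia.
by rewrite /compress_pt; elim: U => //= v W ->; rewrite /in_strip /=; case: ifP.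
Qed.

Lemma compress_col_xv u x : (minx X <= x <= maxx X)%R -> u \in U -> in_cols u x ->
  compress_col x = xv X T u.
Proof.
move=> hx uU ux; have [w [wU wx wun]] := cut_unique hx.
have {wun} un v : v \in U -> in_cols v x -> v = u.
  by move=> vU vx; rewrite (wun _ vU vx) (wun _ uU ux).
rewrite /compress_col; have -> : clamp x = x by rewrite /clamp; lia.
rewrite /compress_pt.
elim: U uU un => //= v W IHW; rewrite inE => uW un.
case: ifP => [hv|hv]; first by rewrite (un v) // mem_head.
apply: IHW => [|z zW]; last by apply: un; rewrite inE zW orbT.
by case/predU1P: uW => // uv; move: hv; rewrite -uv /in_strip -/(in_cols u x) ux.
Qed.

Lemma compress_col_homo x y : (x <= y)%R -> (compress_col x <= compress_col y)%R.
Proof.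
have [p _ hX] := valid_pt_mem ptT.
have cl z : (minx X <= clamp z <= maxx X)%R by rewrite /clamp; lia.
have cc z : compress_col z = compress_col (clamp z).
  by rewrite /compress_col; congr (compress_pt _ _ _ (_, _)).1; have := cl z; rewrite /clamp; lia.
move=> xy; rewrite (cc x) (cc y).
have {xy} : (clamp x <= clamp y)%R by rewrite /clamp; lia.
have := cl y; have := cl x; move: (clamp x) (clamp y) => {}x {}y hx hy xy.
have [u [uU ux unx]] := cut_unique hx; have [w [wU wy uny]] := cut_unique hy.
rewrite (compress_col_xv hx uU ux) (compress_col_xv hy wU wy) leNgt; apply/negP => lt.
have /andP[hu hxu] := xv_in_cols uU; have /andP[hw _] := xv_in_cols wU.
have neq : u != w by apply/eqP => E; rewrite E ltxx in lt.
have [t [_ _ un]] := cut_unique hxu.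
(* Either [y] lies between [x] and the representative of [u], hence in strip [u], or that
   representative lies between the one of [w] and [y], hence in strip [w]. Both contradict
   uniqueness. *)
case/eqP: neq; have [yu|uy] := leP y (xv X T u).
  by apply: uny => //; move: ux hu; rewrite /in_cols; lia.
rewrite (un u) // (un w) //; move: hw wy; rewrite /in_cols; lia.
Qed.

(** Representatives lie in their own disjoint strips; this identifies the fibers in [fiber_cost]
    with the instances [Xs]. *)
Lemma compress_col_eq v x : (minx X <= x <= maxx X)%R -> v \in U ->
  in_cols v x = (compress_col x == xv X T v).
Proof.
move=> hx vU; apply/idP/eqP => [|E]; first exact: compress_col_xv.
have [u [uU ux _]] := cut_unique hx.
have [/andP[hu hxu] /andP[hv _]] := (xv_in_cols uU, xv_in_cols vU).
have [w [_ _ un]] := cut_unique hxu.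
move: E; rewrite (compress_col_xv hx uU ux) => E.
by rewrite (un v) // ?E // -(un u).
Qed.

End Cut.

Theorem theorem3p4 : exists c : nat,
  forall (X : seq point) (T : ptree) (U : seq (seq bool)),
    semi_perm X -> is_ptree X T -> is_cut T U ->
    (WB X <= 4 * WB (Xc X T U) + 8 * \sum_(v <- U) WB (Xs X T v) + c * size X)%N.
Proof.
(* The constant is the weight of the middle in the potential; initially the middle is all of [X]. *)
exists 4 => X T U _ ptT cutU.
suff H (s : seq int) : cost (cols X) s
    <= 4 * WB (Xc X T U) + 8 * \sum_(v <- U) WB (Xs X T v) + 4 * size X.
  by apply/bigmax_leqP_seq => s _ _; rewrite WB_sigmaE.
have colsX x : x \in cols X -> (minx X <= x <= maxx X)%R.
  by rewrite mem_cols => /mapP[p /minx_maxxP ? ->].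
(* One unit beyond the box on each side makes both end strips empty. *)
have inV x : x \in cols X -> (minx X - 1 < compress_col X T U x < maxx X + 1)%R
    && (compress_col X T U x \in map (xv X T) U).
  move=> /colsX hx; have [u [uU ux _]] := cut_unique ptT cutU hx.
  rewrite (compress_col_xv ptT cutU hx uU ux) map_f // andbT.
  by have /andP[_] := xv_in_cols ptT cutU uU; lia.
have := cost_split_bound (compress_col_homo ptT cutU) s inV.
have -> : map (compress_col X T U) (cols X) = cols (Xc X T U).
  by apply/esym/cols_map => p /minx_maxxP; apply: compress_ptE.
have := cost_le_WB (Xc X T U) (compress_lines (compress_col X T U) s).
have : fiber_cost (compress_col X T U) (map (xv X T) U) s (cols X)
    <= \sum_(v <- U) WB (Xs X T v).
  rewrite /fiber_cost big_map !big_seq; apply: leq_sum => v vU.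
  apply: leq_trans (cost_le_WB _ s); rewrite /Xs (cols_filter (in_cols X T v)).
  rewrite (@eq_in_filter _ _ (in_cols X T v)) // => x /colsX hx.
  by rewrite (compress_col_eq ptT cutU hx vU).
rewrite size_map size_sort => leF leC leP; apply: leq_trans leP _.
by rewrite leq_add2r; apply: leq_add; apply: leq_mul.
Qed.
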